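(* Let $V$ be a $\mathbb C$-graded vertex algebra and define $A(V):=V/O(V)$. Then $A(V)$ is an associative algebra with respect to the product induced by $\star$.
   Context: All vector spaces are over $\mathbb{C}$. A vertex algebra $V=(V,Y,\mathbf 1,T)$ has $Y(a,z)=\sum_{n\in\mathbb Z}a(n)z^{-n-1}\in \mathrm{End}(V)[[z,z^{-1}]]$, vacuum $\mathbf 1$, and $T\in\mathrm{End}(V)$ with $[T,Y(a,z)]=\partial_zY(a,z)=Y(Ta,z)$, and satisfies the usual axioms (truncation, vacuum, creativity, Jacobi identity). $\mathbb C$-graded vertex algebra: a vertex algebra with a decomposition $V=\bigoplus_{\mu\in\mathbb C}V_\mu$ such that (i) $a(n)V_\mu\subseteq V_{\mu+\lambda-n-1}$ for $a\in V_\lambda$, $n\in\mathbb Z$; and (ii) $V$ is generated by a set of lowest weight vectors, where a homogeneous $v$ is a lowest weight vector if for every $\lambda$ and $a\in V_\lambda$, $a(n)v\ne0$ implies $n=\lambda-1$ or $n<\mathrm{Re}(\lambda)-1$. For $a\in V_\mu$ write $|a|=\mu$ and $\overline{|a|}=\min\{n\in\mathbb Z: n\ge \mathrm{Re}(\mu)\}$. Let $V^r$ be the span of homogeneous $a$ with $|a|-\overline{|a|}=r$, so $V=\bigoplus_{r}V^r$. For homogeneous $a\in V^r$ and $b\in V$ put $a\circ b=\mathrm{Res}_z\frac{(1+z)^{\overline{|a|}+\delta_{r,0}-1}}{z^{1+\delta_{r,0}}}Y(a,z)b$ and $a\star b=\delta_{r,0}\mathrm{Res}_z\frac{(1+z)^{|a|}}{z}Y(a,z)b$,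 extended linearly in $a$ (powers of $1+z$ are expanded in nonnegative powers of $z$). $O(V)$ is the linear span of all $a\circ b$ with $a,b\in V$. *)

(* Defs.v *)
From HB Require Import structures.
From mathcomp Require Import all_boot all_order all_algebra.
From mathcomp Require Import ring_quotient.
From mathcomp Require Import boolp classical_sets functions cardinality fsbigop.
From mathcomp Require Import reals.
From mathcomp Require Import complex.
Set Implicit Arguments.
Unset Strict Implicit.
Unset Printing Implicit Defensive.
Import Order.TTheory GRing.Theory Num.Theory.
Local Open Scope classical_set_scope.
Local Open Scope complex_scope.
Local Open Scope ring_scope.

(* All sums \sum_(i \in [set: I]) F i below have finite support; fsbigop gives
   the value 0 to a sum with infinite support. *)

Section LinearAlgebra.
Variables (K : pzRingType) (V : lmodType K).

Definition lspan (S : set V) : set V :=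
  [set v | exists2 s : seq (K * V), (forall p, p \in s -> S p.2) &
             v = \sum_(p <- s) p.1 *: p.2].

Definition is_subspace (W : set V) : Prop :=
  W 0 /\ forall (k : K) u v, W u -> W v -> W (k *: u + v).

(* V is the internal direct sum of the W i; the unique f is the family of
   components of v. *)
Definition is_decomposition (I : choiceType) (W : I -> set V) : Prop :=
  (forall i, is_subspace (W i)) /\
  forall v, exists! f : I -> V,
    [/\ forall i, W i (f i), finite_set [set i | f i != 0]
      & v = \sum_(i \in [set: I]) f i].

Lemma lspan_subspace (S : set V) : is_subspace (lspan S).
Proof.
split=> [|k u v [s sS ->] [t tS ->]]; first by exists [::]; rewrite ?big_nil.
exists ([seq (k * p.1, p.2) | p <- s] ++ t) => [p|].
  by rewrite mem_cat => /orP[/mapP[q qs ->]|/tS//]; exact: (sS q qs).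
rewrite big_cat big_map scaler_sumr; congr (_ + _).
by apply: eq_bigr => p _; rewrite scalerA.
Qed.

Definition lspan_pred (S : set V) : {pred V} := fun v => v \in lspan S.

Lemma lspan_pred_submod (S : set V) : submod_closed (lspan_pred S).
Proof.
have [S0 SD] := lspan_subspace S.
split=> [|k u v]; rewrite /lspan_pred !unfold_in /in_mem /=.
  exact: mem_set.
by move=> /set_mem Su /set_mem Sv; apply: mem_set; exact: SD.
Qed.

HB.instance Definition _ (S : set V) :=
  GRing.isSubmodClosed.Build K V (lspan_pred S) (lspan_pred_submod S).

End LinearAlgebra.

Section LmodQuotient.
Variables (K : pzRingType) (V : lmodType K) (S : set V).
Local Notation W := (lspan_pred S).
Local Open Scope quotient_scope.

Definition lquot : Type := Quotient.quot W.

HB.instance Definition _ := GRing.Zmodule.on lquot.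

Definition lproj (v : V) : lquot := \pi_(Quotient.quot W) v.

Lemma lprojE u v : (lproj u = lproj v) <-> (u - v \in W).
Proof. by rewrite Quotient.idealrBE; split=> [/eqP|/eqP]. Qed.

Lemma lproj_is_additive : {morph lproj : u v / u + v}.
Proof. by move=> u v; rewrite /lproj [LHS]raddfD. Qed.

Lemma lproj_surj (x : lquot) : exists v, x = lproj v.
Proof. by exists (repr x); rewrite /lproj reprK. Qed.

Definition lquot_scale (k : K) (x : lquot) : lquot :=
  lproj (k *: (repr (x : Quotient.quot W) : V)).

Lemma lquot_scaleE k v : lquot_scale k (lproj v) = lproj (k *: v).
Proof.
apply/lprojE; rewrite -scalerBr; apply: rpredZ.
by apply/lprojE; rewrite /lproj reprK.
Qed.

Fact lquot_scaleA k l x : lquot_scale k (lquot_scale l x) = lquot_scale (k * l) x.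
Proof. by have [v ->] := lproj_surj x; rewrite !lquot_scaleE scalerA. Qed.

Fact lquot_scale1 : left_id 1 lquot_scale.
Proof. by move=> x; have [v ->] := lproj_surj x; rewrite lquot_scaleE scale1r. Qed.

Fact lquot_scaleDr : right_distributive lquot_scale +%R.
Proof.
move=> k x y; have [u ->] := lproj_surj x; have [v ->] := lproj_surj y.
by rewrite -lproj_is_additive !lquot_scaleE scalerDr lproj_is_additive.
Qed.

Fact lquot_scaleDl x : {morph lquot_scale^~ x : k l / k + l}.
Proof.
have [v ->] := lproj_surj x => k l.
by rewrite !lquot_scaleE scalerDl lproj_is_additive.
Qed.

HB.instance Definition _ := GRing.Zmodule_isLmodule.Build K lquot
  lquot_scaleA lquot_scale1 lquot_scaleDr lquot_scaleDl.

Lemma lproj_is_linear : linear lproj.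
Proof. by move=> k u v; rewrite lproj_is_additive -lquot_scaleE. Qed.

HB.instance Definition _ := GRing.isLinear.Build K V lquot _ lproj lproj_is_linear.

End LmodQuotient.

Definition is_assoc_algebra (K : pzRingType) (A : lmodType K)
    (mul : A -> A -> A) : Prop :=
  [/\ forall x, linear (mul x), forall y, linear (mul^~ y), associative mul
    & exists e, left_id e mul /\ right_id e mul].

(* x (x - 1) ... (x - i + 1) / i! : the coefficient of z^i in (1 + z)^x *)
Definition gbinom (K : fieldType) (x : K) (i : nat) : K :=
  (\prod_(j < i) (x - j%:R)) / i`!%:R.

(* nprod a n b is a(n)b, where Y(a,z) = \sum_n a(n) z^(-n-1). The axioms are
   stated coefficientwise; va_jacobi is the coefficient of
   z0^(-l-1) z1^(-m-1) z2^(-n-1) in the Jacobi identity. *)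
Record vertexAlgebra (R : realType) := VertexAlgebra {
  va_sort :> lmodType R[i];
  nprod : va_sort -> int -> va_sort -> va_sort;
  vacuum : va_sort;
  translation : va_sort -> va_sort;
  va_linearl : forall n b, linear (fun a => nprod a n b);
  va_linearr : forall a n, linear (nprod a n);
  va_translation_linear : linear translation;
  va_truncation : forall a b, exists N : int, forall n, N <= n -> nprod a n b = 0;
  va_vacuum : forall n b, nprod vacuum n b = if n == -1 then b else 0;
  va_creativity : forall a, nprod a (-1) vacuum = a /\
    forall n : int, 0 <= n -> nprod a n vacuum = 0;
  va_translation_comm : forall a n b,
    translation (nprod a n b) - nprod a n (translation b)
      = - (nprod a (n - 1) b *~ n);
  va_translation_deriv : forall a n b,
    nprod (translation a) n b = - (nprod a (n - 1) b *~ n);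
  va_jacobi : forall a b c (l m n : int),
    \sum_(i \in [set: nat]) gbinom (m%:~R : R[i]) i *:
       nprod (nprod a (l + i%:Z) b) (m + n - i%:Z) c
    = \sum_(i \in [set: nat]) ((-1) ^+ i * gbinom (l%:~R : R[i]) i) *:
       (nprod a (m + l - i%:Z) (nprod b (n + i%:Z) c)
        - ((-1) ^ l : R[i]) *: nprod b (n + l - i%:Z) (nprod a (m + i%:Z) c))
}.

Section LowestWeight.
Variables (R : realType) (V : vertexAlgebra R) (gr : R[i] -> set V).

Definition lowest_weight (v : V) : Prop :=
  (exists mu, gr mu v) /\
  forall (la : R[i]) (a : V) (n : int), gr la a -> nprod a n v != 0 ->
    n%:~R = la - 1 \/ (n%:~R : R) < complex.Re la - 1.

(* Generation of V as a module over itself: the only subspace that contains S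
   and is stable under all the operators a(n) is V. *)
Definition generates (S : set V) : Prop :=
  forall W : set V, is_subspace W -> S `<=` W ->
    (forall a n w, W w -> W (nprod a n w)) -> W = setT.

End LowestWeight.

Record cgradedVertexAlgebra (R : realType) := CGradedVertexAlgebra {
  cg_va :> vertexAlgebra R;
  gr : R[i] -> set cg_va;
  gr_decomposition : is_decomposition gr;
  gr_nprod : forall (la mu : R[i]) a b (n : int), gr la a -> gr mu b ->
    gr (mu + la - n%:~R - 1) (nprod a n b);
  gr_generated : exists S : set cg_va,
    (forall v, S v -> lowest_weight gr v) /\ generates S
}.

Section ZhuAlgebra.
Variables (R : realType) (V : cgradedVertexAlgebra R).

Definition gcomp (v : V) : R[i] -> V :=
  projT1 (cid ((gr_decomposition V).2 v)).

Definition ceil_weight (mu : R[i]) : int := Num.ceil (complex.Re mu).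

(* The r such that the homogeneous space of weight mu lies in V^r. *)
Definition wshift (mu : R[i]) : R[i] := mu - (ceil_weight mu)%:~R.

(* Res_z (1+z)^p z^(-k) Y(a,z)b: the coefficient of z^i in (1+z)^p is
   paired with the coefficient a(i-k)b of z^(k-i-1) in Y(a,z)b. *)
Definition resY (p : R[i]) (k : int) (a b : V) : V :=
  \sum_(i \in [set: nat]) gbinom p i *: nprod a (i%:Z - k) b.

Definition hcirc (mu : R[i]) (a b : V) : V :=
  let delta := (wshift mu == 0) : nat in
  resY ((ceil_weight mu)%:~R + delta%:R - 1) (1 + delta%:Z) a b.

Definition hstar (mu : R[i]) (a b : V) : V :=
  (wshift mu == 0)%:R *: resY mu 1 a b.

Definition circ (a b : V) : V := \sum_(mu \in [set: R[i]]) hcirc mu (gcomp a mu) b.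

Definition star (a b : V) : V := \sum_(mu \in [set: R[i]]) hstar mu (gcomp a mu) b.

Definition circ_set : set V := [set circ p.1 p.2 | p in [set: V * V]].

Definition Oset : set V := lspan circ_set.

(* lquot S is the quotient by lspan S, so zhu is V / Oset. *)
Definition zhu : lmodType R[i] := lquot circ_set.

Definition zhu_proj : {linear V -> zhu} := lproj circ_set.

Lemma zhu_proj_surj (x : zhu) : exists v, x = zhu_proj v.
Proof. exact: lproj_surj. Qed.

Lemma zhu_proj_eq0 (v : V) : zhu_proj v = 0 <-> Oset v.
Proof.
rewrite -(raddf0 zhu_proj) lprojE subr0.
by split=> [/set_mem//|Ov]; apply: mem_set.
Qed.

End ZhuAlgebra.

(* Main.v *)
(* Write R_{p,k}(a)b for Res_z (1+z)^p z^(-k) Y(a,z)b. Taking the residue of the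
   Jacobi identity against (1+z)^q (1+w)^p w^(-k) (z-w)^l gives one identity
   from which everything follows. With l = -1 and q = |a| it yields
   associativity, and also that R_{|a|,1}(a) preserves O(V) when |a| is an
   integer; with l = 0 and q = |a| - 1 it yields that R_{|a|-1,0}(a), hence
   R_{|a|-1,1}(a), preserves O(V). The latter operator is, modulo O(V), right
   multiplication by a: this comes from skew symmetry, since T acts on a vector
   of integral weight m as -m. So O(V) is a two-sided ideal. Vectors a of
   nonintegral weight lie in O(V) because a is the circle product of a and the
   vacuum. *)
From HB Require Import structures.
From mathcomp Require Import all_boot all_order all_algebra.
From mathcomp Require Import finmap boolp classical_sets functions cardinality.
From mathcomp Require Import fsbigop reals complex zify ring.
Require Import Defs.
Set Implicit Arguments.
Unset Strict Implicit.
Unset Printing Implicit Defensive.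
Import Order.TTheory GRing.Theory Num.Theory.
Local Open Scope classical_set_scope.
Local Open Scope ring_scope.

(** * Generalized binomial coefficients *)

Section GeneralizedBinomial.
Variable K : numFieldType.
Implicit Types x y : K.

Lemma gbinom0 x : gbinom x 0 = 1.
Proof. by rewrite /gbinom big_ord0 fact0 divr1. Qed.

Lemma gbinomS x n : n.+1%:R * gbinom x n.+1 = (x - n%:R) * gbinom x n.
Proof.
rewrite /gbinom big_ord_recr factS natrM /=.
have nz : n.+1%:R != 0 :> K by rewrite pnatr_eq0.
have fz : (n`!)%:R != 0 :> K by rewrite pnatr_eq0 -lt0n fact_gt0.
by move: nz fz; move: (n.+1%:R) (n`!%:R) => s t nz fz; field; rewrite fz nz.
Qed.

Lemma gbinomSE x n : gbinom x n.+1 = (x - n%:R) / n.+1%:R * gbinom x n.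
Proof.
apply: (@mulfI _ n.+1%:R); first by rewrite pnatr_eq0.
by rewrite gbinomS [in RHS]mulrA (mulrCA n.+1%:R) divff ?mulr1 // pnatr_eq0.
Qed.

Lemma gbinomP x n : gbinom (x + 1) n.+1 = gbinom x n.+1 + gbinom x n.
Proof.
elim: n => [|n IHn]; first by rewrite !gbinomSE !gbinom0 !mulr1 !divr1 !subr0.
apply: (@mulfI _ n.+2%:R); first by rewrite pnatr_eq0.
rewrite mulrDr !gbinomS IHn.
have h := gbinomS x n; rewrite -(natr1 n.+1).
have -> : x + 1 - n.+1%:R = x - n%:R by rewrite -natr1; ring.
rewrite mulrDr -h -{1}natr1. ring.
Qed.

Lemma gbinom_absorb x n : n.+1%:R * gbinom (x + 1) n.+1 = (x + 1) * gbinom x n.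
Proof. by rewrite gbinomP mulrDr gbinomS -natr1; ring. Qed.

Lemma gbinom_nat (n i : nat) : (n < i)%N -> gbinom (n%:R : K) i = 0.
Proof.
elim: i n => // i IHi n; rewrite ltnS leq_eqVlt => /orP[/eqP <-|lt_ni].
  by rewrite gbinomSE subrr !mul0r.
by rewrite gbinomSE IHi ?mulr0.
Qed.

Lemma gbinom0n i : gbinom (0 : K) i = (i == 0%N)%:R.
Proof. by case: i => [|i]; rewrite ?gbinom0 // (@gbinom_nat 0). Qed.

Lemma gbinomN1 i : gbinom (-1 : K) i = (-1) ^+ i.
Proof.
elim: i => [|i IHi]; first by rewrite gbinom0.
rewrite gbinomSE IHi exprS; congr (_ * _); rewrite -opprD nat1r mulNr divff //.
by rewrite pnatr_eq0.
Qed.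

(** Trinomial revision. The induction on [i] trades one unit of [i] for one of [m], the factors
    being matched by [gbinomS] and [gbinom_absorb]. *)
Lemma gbinomMbin x (m i : nat) :
  gbinom x (m + i) * gbinom ((m + i)%:R : K) i
  = gbinom x i * gbinom (x - i%:R) m.
Proof.
elim: i m => [|i IHi] m; first by rewrite addn0 !gbinom0 subr0 mulr1 mul1r.
have nz : i.+1%:R != 0 :> K by rewrite pnatr_eq0.
apply: (@mulfI _ i.+1%:R) => //.
have hm := gbinomS (m + i.+1)%:R i.
have hx := gbinomS x i.
have ha := gbinom_absorb (x - i.+1%:R) m.
have e : x - i.+1%:R + 1 = x - i%:R by rewrite -natr1; ring.
have em : (m + i.+1)%:R - i%:R = m.+1%:R :> K by rewrite -addSnnS natrD addrK.
rewrite e in ha; rewrite em in hm.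
have IH := IHi m.+1; rewrite addSnnS in IH.
by rewrite mulrCA hm mulrCA IH mulrCA ha mulrCA mulrA -hx -mulrA.
Qed.

Lemma gbinom_negate x n :
  gbinom (n%:R - x) n = (-1) ^+ n * gbinom (x - 1) n.
Proof.
elim: n x => [|n IHn] x; first by rewrite !gbinom0 mulr1.
have nz : n.+1%:R != 0 :> K by rewrite pnatr_eq0.
apply: (@mulfI _ n.+1%:R) => //.
have -> : n.+1%:R - x = (n%:R - x) + 1 by rewrite -natr1; ring.
by rewrite gbinom_absorb IHn [in RHS]mulrCA gbinomS exprS; ring.
Qed.

(** After multiplication by [n + 1], the splitting [n + 1 = i + (n + 1 - i)] lets [gbinomS] act on
    one factor at a time; the resulting factors [x - i] and [y - (n - i)] add up to [x + y - n]. *)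
Lemma gbinom_vandermonde x y n :
  \sum_(i < n.+1) gbinom x i * gbinom y (n - i) = gbinom (x + y) n.
Proof.
elim: n => [|n IHn]; first by rewrite big_ord1 !gbinom0 mulr1.
have nz : n.+1%:R != 0 :> K by rewrite pnatr_eq0.
apply: (@mulfI _ n.+1%:R) => //; rewrite gbinomS -IHn mulr_sumr.
transitivity (\sum_(i < n.+2) (i%:R * gbinom x i * gbinom y (n.+1 - i)
   + gbinom x i * ((n.+1 - i)%:R * gbinom y (n.+1 - i)))).
  apply: eq_bigr => i _.
  have -> : n.+1%:R = i%:R + (n.+1 - i)%:R :> K by rewrite -natrD subnKC // -ltnS.
  by ring.
rewrite big_split big_ord_recl /= !mul0r add0r.
rewrite [X in _ + X]big_ord_recr /= subnn mul0r mulr0 addr0.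
rewrite -big_split mulr_sumr; apply: eq_bigr => i _ /=.
have lein : (i <= n)%N by rewrite -ltnS.
rewrite /bump /= add1n subSS gbinomS subSn // gbinomS natrB //; ring.
Qed.

End GeneralizedBinomial.

(** * Rearranging sums of finite support *)

Section FiniteSupportSums.
Variables (K : pzRingType) (V : lmodType K).
Implicit Types F G : nat -> V.

Lemma fsum_natE (N : nat) F : (forall i, (N <= i)%N -> F i = 0) ->
  \sum_(i \in [set: nat]) F i = \sum_(i < N) F i.
Proof.
move=> F0; rewrite [RHS](@fsbig_ord V 0 _ N F).
apply/esym/fsbig_widen => // i /= -[_ /negP]; rewrite -leqNgt; exact: F0.
Qed.

Lemma big_ord_nat0 (M N : nat) F : (M <= N)%N ->
  (forall i, (M <= i)%N -> F i = 0) -> \sum_(i < N) F i = \sum_(i < M) F i.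
Proof.
move=> leMN F0; rewrite !(big_ord_widen _ _ leMN).
rewrite [LHS](bigID (fun i : 'I_N => (i < M)%N)) /=.
rewrite [X in _ + X]big1 ?addr0 // => i; rewrite -leqNgt; exact: F0.
Qed.

Lemma triangular_sum (N : nat) (F : nat -> nat -> V) :
  (forall i j, (N <= i + j)%N -> F i j = 0) ->
  \sum_(i < N) \sum_(j < N) F i j
  = \sum_(s < N) \sum_(i < s.+1) F i (s - i)%N.
Proof.
move=> F0.
transitivity (\sum_(i < N) \sum_(s < N | (i <= s)%N) F i (s - i)%N).
  apply: eq_bigr => i _; rewrite -(@big_mkord _ _ _ _ xpredT (F i)).
  rewrite -(@big_mkord _ _ _ _ (fun s => (i <= s)%N) (fun s => F i (s - i)%N)).
  have leiN := ltnW (ltn_ord i).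
  rewrite [RHS](@big_cat_nat _ _ _ i) //=.
  have -> : \sum_(0 <= s < i | (i <= s)%N) F i (s - i)%N = 0.
    rewrite big_nat_cond big1 // => s /andP[/andP[_ lt_si] le_is].
    by move: lt_si; rewrite ltnNge le_is.
  have -> : \sum_(i <= s < N | (i <= s)%N) F i (s - i)%N
    = \sum_(i <= s < N) F i (s - i)%N.
    rewrite big_nat_cond [RHS]big_nat_cond; apply: eq_bigl => s.
    by case: (leqP i s); rewrite ?andbT ?andbF.
  rewrite add0r -{2}[i : nat]add0n big_addn.
  rewrite (@big_cat_nat _ _ _ (N - i)) ?leq_subr //=.
  have -> : \sum_(N - i <= s < N) F i s = 0.
    rewrite big_nat_cond big1 // => s /andP[/andP[les _] _].
    by apply: F0; rewrite -leq_subLR.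
  by rewrite addr0; apply: eq_bigr => s _; rewrite addnK.
rewrite (exchange_big_dep xpredT) //=; apply: eq_bigr => s _.
by rewrite (big_ord_widen _ (fun i => F i (s - i)%N) (ltn_ord s)).
Qed.

End FiniteSupportSums.

(** * Products of binomial series *)

Section Convolution.
Variables (K : numFieldType) (V : lmodType K).

Lemma gbinom_conv (x y : K) (f : nat -> V) (L M N : nat) :
  (L <= M)%N -> (L <= N)%N -> (forall s, (L <= s)%N -> f s = 0) ->
  \sum_(m < M) \sum_(n < N) (gbinom x m * gbinom y n) *: f (m + n)%N
  = \sum_(s < L) gbinom (x + y) s *: f s.
Proof.
move=> LM LN f0.
pose F m n := (gbinom x m * gbinom y n) *: f (m + n)%N.
have F0 m n : (L <= m + n)%N -> F m n = 0 by move=> /f0 e; rewrite /F e scaler0.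
transitivity (\sum_(m < L) \sum_(n < L) F m n).
  rewrite (@big_ord_nat0 _ _ L M (fun m => \sum_(n < N) F m n)) //; last first.
    move=> m Lm; rewrite big1 // => n _; apply: F0; exact: leq_trans (leq_addr _ _).
  apply: eq_bigr => m _; rewrite (@big_ord_nat0 _ _ L N (F m)) // => n Ln.
  by apply: F0; exact: leq_trans (leq_addl _ _).
rewrite triangular_sum //; apply: eq_bigr => s _.
rewrite -gbinom_vandermonde scaler_suml; apply: eq_bigr => i _.
by rewrite /F subnKC // -ltnS.
Qed.

(** Coefficient form of [(1+z)^y] times the [i]-th divided derivative of [(1+z)^x], which is
    [gbinom x i] times [(1+z)^(x-i)]. The range of [m] is doubled so that at least [N] indices
    survive the shift by [i]; for [m < i] the factor [gbinom m i] vanishes, which makes the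
    truncated subtraction harmless. *)
Lemma gbinom_conv_shift (x y : K) (f : nat -> V) (N i : nat) :
  (i <= N)%N -> (forall s, (N <= s)%N -> f s = 0) ->
  \sum_(m < N + N) \sum_(n < N)
     (gbinom x m * gbinom y n * gbinom (m%:R : K) i) *: f (m + n - i)%N
  = gbinom x i *: \sum_(s < N) gbinom (y + x - i%:R) s *: f s.
Proof.
move=> leiN f0.
pose G m := \sum_(n < N)
     (gbinom x m * gbinom y n * gbinom (m%:R : K) i) *: f (m + n - i)%N.
rewrite -[LHS](@big_mkord _ _ _ _ xpredT G).
rewrite (@big_cat_nat _ _ _ i) //=; last by rewrite (leq_trans leiN) ?leq_addr.
have -> : \sum_(0 <= m < i) G m = 0.
  rewrite big_nat_cond big1 // => m /andP[/andP[_ mi] _].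
  by rewrite /G big1 // => n _; rewrite gbinom_nat // mulr0 scale0r.
rewrite add0r -[X in \sum_(X <= _ < _) _]add0n big_addn big_mkord.
have e : y + x - i%:R = (x - i%:R) + y by ring.
rewrite e -(@gbinom_conv _ _ f N (N + N - i) N) //; last first.
  by rewrite -addnBA // leq_addr.
rewrite scaler_sumr; apply: eq_bigr => m _.
rewrite scaler_sumr; apply: eq_bigr => n _.
rewrite scalerA; congr (_ *: f _); last by rewrite addnAC addnK.
by rewrite mulrAC gbinomMbin -mulrA.
Qed.

End Convolution.

Lemma bounded_family (P : nat -> int -> Prop) :
  (forall i, exists N : nat, forall n : int, N%:Z <= n -> P i n) ->
  forall L : nat, exists N : nat,
    forall i, (i < L)%N -> forall n : int, N%:Z <= n -> P i n.
Proof.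
move=> PN; elim=> [|L [N hN]]; first by exists 0%N.
have [N' hN'] := PN L; exists (N + N')%N => i; rewrite ltnS leq_eqVlt.
case/orP => [/eqP->|iL] n hn; first by apply: hN'; lia.
by apply: hN => //; lia.
Qed.

(** * Modes and residues *)

Section Modes.
Variables (R : realType) (V : cgradedVertexAlgebra R).
Local Notation C := (R[i]).
Implicit Types (a b c : V) (p q : C) (k l m n : int).

HB.instance Definition _ a n :=
  GRing.isLinear.Build C V V *:%R (nprod a n) (va_linearr a n).

(** The left factor comes last so that linearity in it can be declared as an instance; [resYl] and
    [starl] serve the same purpose. *)
Definition nprodl n b a : V := nprod a n b.

HB.instance Definition _ n b :=
  GRing.isLinear.Build C V V *:%R (nprodl n b) (va_linearl n b).

Lemma nprod0l n b : nprod 0 n b = 0.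
Proof. exact: (raddf0 (nprodl n b)). Qed.

Lemma truncation a b :
  exists N : nat, forall n, N%:Z <= n -> nprod a n b = 0.
Proof.
have [N hN] := va_truncation a b; exists `|N|%N => n hn.
by apply: hN; apply: le_trans hn; lia.
Qed.

Lemma resYE (N : nat) p k a b :
  (forall i : nat, (N <= i)%N -> nprod a (i%:Z - k) b = 0) ->
  resY p k a b = \sum_(i < N) gbinom p i *: nprod a (i%:Z - k) b.
Proof. by move=> h; apply: fsum_natE => i /h ->; rewrite scaler0. Qed.

Lemma resY_trunc a b k : exists N : nat,
  forall i : nat, (N <= i)%N -> nprod a (i%:Z - k) b = 0.
Proof.
have [N hN] := truncation a b; exists (N + `|k|)%N => i hi; apply: hN; lia.
Qed.

Lemma resY_linear p k a : linear (resY p k a).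
Proof.
move=> x u v.
have [N1 h1] := resY_trunc a u k; have [N2 h2] := resY_trunc a v k.
have h1' i : (N1 + N2 <= i)%N -> nprod a (i%:Z - k) u = 0.
  by move=> ?; apply: h1; lia.
have h2' i : (N1 + N2 <= i)%N -> nprod a (i%:Z - k) v = 0.
  by move=> ?; apply: h2; lia.
rewrite (resYE _ h1') (resYE _ h2') (@resYE (N1 + N2)); last first.
  by move=> i hi; rewrite linearP /= h1' // h2' // scaler0 addr0.
rewrite scaler_sumr -big_split; apply: eq_bigr => i _ /=.
by rewrite linearP /= scalerDr !scalerA mulrC.
Qed.

HB.instance Definition _ p k a :=
  GRing.isLinear.Build C V V *:%R (resY p k a) (resY_linear p k a).

Lemma resY_linearl p k b : linear (fun a => resY p k a b).
Proof.
move=> x u v.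
have [N1 h1] := resY_trunc u b k; have [N2 h2] := resY_trunc v b k.
have h1' i : (N1 + N2 <= i)%N -> nprod u (i%:Z - k) b = 0.
  by move=> ?; apply: h1; lia.
have h2' i : (N1 + N2 <= i)%N -> nprod v (i%:Z - k) b = 0.
  by move=> ?; apply: h2; lia.
have e i :
    nprod (x *: u + v) (i%:Z - k) b = x *: nprod u (i%:Z - k) b + nprod v (i%:Z - k) b.
  exact: (linearP (nprodl (i%:Z - k) b)).
rewrite (resYE _ h1') (resYE _ h2') (@resYE (N1 + N2)); last first.
  by move=> i hi; rewrite e h1' // h2' // scaler0 addr0.
rewrite scaler_sumr -big_split; apply: eq_bigr => i _ /=.
by rewrite e scalerDr !scalerA mulrC.
Qed.

Definition resYl p k b a : V := resY p k a b.

HB.instance Definition _ p k b :=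
  GRing.isLinear.Build C V V *:%R (resYl p k b) (resY_linearl p k b).

(** Residue form of [(1+z)^(p+1) z^(-k-1) = (1+z)^p z^(-k-1) + (1+z)^p z^(-k)]. *)
Lemma resY_pascal p k a b :
  resY (p + 1) (k + 1) a b = resY p (k + 1) a b + resY p k a b.
Proof.
have [N hN] := resY_trunc a b k; have [M hM] := resY_trunc a b (k + 1).
pose L := (N + M).+1.
have hL i : (L <= i)%N -> nprod a (i%:Z - (k + 1)) b = 0.
  by move=> ?; apply: hM; lia.
rewrite !(resYE _ hL) (@resYE (N + M)); last by move=> i hi; apply: hN; lia.
rewrite !big_ord_recl !gbinom0 -addrA; congr (_ + _).
rewrite -big_split; apply: eq_bigr => i _; rewrite lift0.
have -> : i.+1%:Z - (k + 1) = i%:Z - k by lia.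
by rewrite gbinomP scalerDl.
Qed.

(** Integration by parts: [Y(Ta,z)] is the derivative of [Y(a,z)], and a total derivative has
    residue zero, so the derivative passes with a minus sign to [(1+z)^(p+1) z^(-k)]. *)
Lemma resY_translation p k a b :
  resY (p + 1) k (translation a) b
  = k%:~R *: resY (p + 1) (k + 1) a b - (p + 1) *: resY p k a b.
Proof.
have [N hN] := resY_trunc a b k; have [M hM] := resY_trunc a b (k + 1).
pose L := (N + M).+1.
have hL i : (L <= i)%N -> nprod a (i%:Z - (k + 1)) b = 0.
  by move=> ?; apply: hM; lia.
have e (i : nat) : nprod (translation a) (i%:Z - k) b
    = (k%:~R - i%:R : C) *: nprod a (i%:Z - (k + 1)) b.
  rewrite va_translation_deriv -scaler_int -scaleNr.
  by congr (_ *: nprod a _ _); [rewrite rmorphB /= opprB|lia].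
rewrite (resYE _ hL) (@resYE L); last by move=> i hi; rewrite e hL // scaler0.
rewrite (@resYE (N + M)); last by move=> i hi; apply: hN; lia.
transitivity (k%:~R *: (\sum_(i < L) gbinom (p + 1) i *: nprod a (i%:Z - (k + 1)) b)
   - \sum_(i < L) (i%:R * gbinom (p + 1) i) *: nprod a (i%:Z - (k + 1)) b).
  rewrite scaler_sumr -sumrB; apply: eq_bigr => i _.
  by rewrite e !scalerA -scalerBl; congr (_ *: _); ring.
congr (_ - _); rewrite big_ord_recl mul0r scale0r add0r scaler_sumr.
apply: eq_bigr => i _; rewrite lift0 scalerA gbinom_absorb.
by congr (_ *: nprod a _ b); lia.
Qed.

End Modes.

(** * The weighted Jacobi identity *)

Section WeightedJacobi.
Variables (R : realType) (V : cgradedVertexAlgebra R).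
Local Notation C := (R[i]).
Implicit Types (a b c : V) (p q : C) (k l m n : int).

(* The residue of the Jacobi identity for [Y(a,z)] and [Y(b,w)] against
   [(1+z)^q (1+w)^p w^(-k) (z-w)^l]. *)
Lemma weighted_jacobi p q k l a b c : exists N : nat,
  \sum_(i \in [set: nat])
     gbinom q i *: resY (p + q - i%:R) k (nprod a (l + i%:Z) b) c
  = \sum_(i < N.+1) ((-1) ^+ i * gbinom (l%:~R : C) i) *:
      (resY q (i%:Z - l) a (resY p (k - i%:Z) b c)
       - ((-1) ^ l : C) *: resY p (k + i%:Z - l) b (resY q (- i%:Z) a c)).
Proof.
have [Nab hab] := truncation a b.
have [Nbc hbc] := truncation b c.
have [Nac hac] := truncation a c.
(* Inner products vanish from index [L] on. Only finitely many inner vectors remain, so [N1], [N2],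
   [N3] bound the outer modes uniformly. *)
pose L := (Nab + Nbc + Nac + `|l| + `|k|)%N.
have [N1 h1] := @bounded_family (fun s n => nprod a n (nprod b (s%:Z - k) c) = 0)
  (fun s => truncation a (nprod b (s%:Z - k) c)) L.
have [N2 h2] := @bounded_family (fun s n => nprod b n (nprod a s%:Z c) = 0)
  (fun s => truncation b (nprod a s%:Z c)) L.
have [N3 h3] := @bounded_family (fun i n => nprod (nprod a (l + i%:Z) b) n c = 0)
  (fun i => truncation (nprod a (l + i%:Z) b) c) L.
(* The bound is a successor so that the term [i = 0] can be split off later. *)
pose N' := (L + L + N1 + N2 + N3)%N; exists N'; pose N := N'.+1; rewrite -/N.
have T0 (i : nat) : (L <= i)%N -> nprod a (l + i%:Z) b = 0.
  by move=> hi; apply: hab; lia.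
have T1 (i j : nat) : (L <= i + j)%N -> nprod b (j%:Z - k + i%:Z) c = 0.
  by move=> hi; apply: hbc; lia.
have T2 (i m : nat) : (L <= i + m)%N -> nprod a (m%:Z + i%:Z) c = 0.
  by move=> hi; apply: hac; lia.
have T3 (i j m : nat) : (N <= m)%N ->
    nprod a (m%:Z + l - i%:Z) (nprod b (j%:Z - k + i%:Z) c) = 0.
  move=> hm; have [/T1->|lt] := leqP L (i + j); first by rewrite raddf0.
  have -> : j%:Z - k + i%:Z = (i + j)%N%:Z - k by lia.
  by apply: h1 => //; lia.
have T4 (i j m : nat) : (N <= j)%N ->
    nprod b (j%:Z - k + l - i%:Z) (nprod a (m%:Z + i%:Z) c) = 0.
  move=> hm; have [/T2->|lt] := leqP L (i + m); first by rewrite raddf0.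
  have -> : m%:Z + i%:Z = (i + m)%N%:Z by lia.
  by apply: h2 => //; lia.
have T5 (i s : nat) : (N <= s)%N -> nprod (nprod a (l + i%:Z) b) (s%:Z - k) c = 0.
  move=> hs; have [/T0->|lt] := leqP L i; first by rewrite nprod0l.
  by apply: h3 => //; lia.
have LN : (L <= N)%N by lia.
(* [P] adds up the left-hand sides of [va_jacobi] at the indices [l], [m], [j - k], weighted by the
   coefficients of [(1+z)^q] and [(1+w)^p]. The range [N + N] is the one in [gbinom_conv_shift]. *)
pose P := \sum_(m < N + N) gbinom q m *: \sum_(j < N) gbinom p j *:
  \sum_(i < N) gbinom (m%:R : C) i *:
     nprod (nprod a (l + i%:Z) b) (m%:Z + (j%:Z - k) - i%:Z) c.
transitivity P.
  rewrite (@fsum_natE _ _ N); last first.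
    move=> i Ni; rewrite T0 ?(leq_trans LN) //.
    by rewrite [resY _ _ _ _](raddf0 (resYl _ _ _)) scaler0.
  transitivity (\sum_(i < N) \sum_(m < N + N) \sum_(j < N)
     (gbinom q m * gbinom p j * gbinom (m%:R : C) i) *:
       nprod (nprod a (l + i%:Z) b) ((m + j - i)%N%:Z - k) c).
    apply: eq_bigr => i _.
    rewrite (@resYE _ _ N); last by move=> s; exact: T5.
    by rewrite -(@gbinom_conv_shift _ _ q p
      (fun s => nprod (nprod a (l + i%:Z) b) (s%:Z - k) c))
      ?(ltnW (ltn_ord i)) // => s; exact: T5.
  rewrite exchange_big; apply: eq_bigr => m _.
  rewrite exchange_big scaler_sumr; apply: eq_bigr => j _.
  rewrite scaler_sumr scaler_sumr; apply: eq_bigr => i _; rewrite !scalerA.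
  (* For [i <= m] truncated and integer subtraction agree; otherwise the coefficient is zero. *)
  have [lemi|ltmi] := leqP i m; last by rewrite gbinom_nat // mulr0 !scale0r.
  by congr (_ *: nprod _ _ _); lia.
transitivity (\sum_(m < N + N) gbinom q m *: \sum_(j < N) gbinom p j *:
  \sum_(i < N) ((-1) ^+ i * gbinom (l%:~R : C) i) *:
     (nprod a (m%:Z + l - i%:Z) (nprod b (j%:Z - k + i%:Z) c)
      - ((-1) ^ l : C) *: nprod b (j%:Z - k + l - i%:Z) (nprod a (m%:Z + i%:Z) c))).
  apply: eq_bigr => m _; congr (_ *: _); apply: eq_bigr => j _; congr (_ *: _).
  have := va_jacobi a b c l m%:Z (j%:Z - k).
  rewrite (@fsum_natE _ _ N); last first.
    by move=> i Ni; rewrite T0 ?nprod0l ?scaler0 // (leq_trans LN).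
  rewrite (@fsum_natE _ _ N) //.
  move=> i Ni; have Li := leq_trans LN Ni.
  by rewrite T1 ?T2 ?ltn_addr ?(leq_trans Li) ?leq_addr // !(raddf0, subrr).
under eq_bigr => m _ do rewrite scaler_sumr.
under eq_bigr => m _ do under eq_bigr => j _ do rewrite 2!scaler_sumr.
under eq_bigr => m _ do rewrite exchange_big.
rewrite exchange_big /=; apply: eq_bigr => i _.
rewrite (@resYE _ _ N _ (k - _)); last first.
  move=> j Nj; have -> : j%:Z - (k - i%:Z) = j%:Z - k + i%:Z by lia.
  by apply: T1; lia.
rewrite (@resYE _ _ (N + N) _ (- _)); last first.
  by move=> m Nm; rewrite opprK; apply: T2; lia.
rewrite (@resYE _ _ (N + N)); last first.
  move=> m Nm; rewrite linear_sum big1 // => j _; rewrite linearZ /=.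
  have -> : j%:Z - (k - i%:Z) = j%:Z - k + i%:Z by lia.
  have -> : m%:Z - (i%:Z - l) = m%:Z + l - i%:Z by lia.
  by rewrite T3 ?scaler0 //; lia.
rewrite (@resYE _ _ N); last first.
  move=> j Nj; rewrite linear_sum big1 // => m _; rewrite linearZ /=.
  have -> : j%:Z - (k + i%:Z - l) = j%:Z - k + l - i%:Z by lia.
  by rewrite opprK T4 ?scaler0 //; lia.
have -> : \sum_(j < N) gbinom p j *: nprod b (j%:Z - (k + i%:Z - l))
    (\sum_(m < N + N) gbinom q m *: nprod a (m%:Z - - i%:Z) c)
  = \sum_(m < N + N) \sum_(j < N) (gbinom q m * gbinom p j) *:
     nprod b (j%:Z - k + l - i%:Z) (nprod a (m%:Z + i%:Z) c).
  rewrite exchange_big; apply: eq_bigr => j _.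
  rewrite linear_sum scaler_sumr; apply: eq_bigr => m _.
  rewrite linearZ /= scalerA mulrC opprK.
  by congr (_ *: nprod b _ _); lia.
rewrite scaler_sumr -sumrB scaler_sumr; apply: eq_bigr => m _.
rewrite linear_sum !scaler_sumr -sumrB scaler_sumr; apply: eq_bigr => j _.
rewrite (linearZ_LR (nprod a _)) !scalerBr !scalerA.
congr (_ *: nprod a _ (nprod b _ c) - _ *: _); [ring|lia|lia|ring].
Qed.

End WeightedJacobi.

(** * Integral and nonintegral weights *)

Section Weights.
Variable R : realType.
Implicit Types (mu : R[i]) (n : int).

Lemma Re_int n : complex.Re (n%:~R : R[i]) = n%:~R.
Proof. by rewrite -(rmorph_int (real_complex R)). Qed.

Lemma ceil_weightD mu n : ceil_weight (mu + n%:~R) = ceil_weight mu + n.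
Proof.
rewrite /ceil_weight -[n in RHS](@intrKceil R) -ceilDrz ?intr_int // -Re_int.
by case: mu (n%:~R : R[i]) => [? ?] [? ?].
Qed.

Lemma wshiftD mu n : wshift (mu + n%:~R) = wshift mu.
Proof. by rewrite /wshift ceil_weightD rmorphD /=; ring. Qed.

Lemma ceil_weight_int n : ceil_weight (n%:~R : R[i]) = n.
Proof. by rewrite /ceil_weight Re_int intrKceil. Qed.

Lemma wshift_int n : wshift (n%:~R : R[i]) = 0.
Proof. by rewrite /wshift ceil_weight_int subrr. Qed.

Lemma wshift_eq0 mu : wshift mu = 0 -> mu = (ceil_weight mu)%:~R.
Proof. by move/eqP; rewrite subr_eq0 => /eqP. Qed.

(** Exponent of [1+z] in the circle product; [circ_pole] is the order of its pole. An integral shift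
    of the weight shifts the exponent equally and leaves the pole unchanged, which is what makes the
    ideal property work. *)
Definition circ_exp mu : R[i] :=
  (ceil_weight mu)%:~R + (wshift mu == 0)%:R - 1.

Definition circ_pole mu : int := 1 + (wshift mu == 0 : nat)%:Z.

Lemma circ_expD mu n : circ_exp (mu + n%:~R) = circ_exp mu + n%:~R.
Proof. by rewrite /circ_exp ceil_weightD wshiftD rmorphD /=; ring. Qed.

Lemma circ_poleD mu n : circ_pole (mu + n%:~R) = circ_pole mu.
Proof. by rewrite /circ_pole wshiftD. Qed.

Lemma circ_exp_int n : circ_exp n%:~R = n%:~R.
Proof. by rewrite /circ_exp ceil_weight_int wshift_int eqxx addrK. Qed.

Lemma circ_pole_int n : circ_pole n%:~R = 2.
Proof. by rewrite /circ_pole wshift_int eqxx. Qed.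

End Weights.

(** * Homogeneous components *)

Section Grading.
Variables (R : realType) (V : cgradedVertexAlgebra R).
Local Notation C := (R[i]).
Implicit Types (a b c u v : V) (mu nu : C).

Lemma gcompP v : [/\ forall mu, gr mu (gcomp v mu),
  finite_set [set mu | gcomp v mu != 0] & v = \sum_(mu \in [set: C]) gcomp v mu].
Proof. by rewrite /gcomp; case: (projT2 (cid ((gr_decomposition V).2 v))). Qed.

Lemma gcomp_unique v (f : C -> V) : (forall mu, gr mu (f mu)) ->
  finite_set [set mu | f mu != 0] -> v = \sum_(mu \in [set: C]) f mu ->
  gcomp v = f.
Proof.
move=> f1 f2 f3; rewrite /gcomp.
by case: (projT2 (cid ((gr_decomposition V).2 v))) => _; apply.
Qed.

Lemma fsum_supp (U : zmodType) (A : {fset C}) (F : C -> U) :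
  (forall mu, mu \notin A -> F mu = 0) ->
  \sum_(mu \in [set: C]) F mu = \sum_(mu <- A) F mu.
Proof. by move=> F0; rewrite (fsbigTE A). Qed.

Lemma gcomp_supp v : exists A : {fset C}, forall mu, mu \notin A -> gcomp v mu = 0.
Proof.
have [_ fv _] := gcompP v.
exists (fset_set [set mu | gcomp v mu != 0]) => mu.
rewrite in_fset_set // => /negP h; apply/eqP.
by apply: contra_notT h => h; exact: mem_set.
Qed.

Lemma gr_subspace mu : is_subspace (@gr R V mu).
Proof. exact: (gr_decomposition V).1. Qed.

Lemma gr0 mu : gr mu (0 : V). Proof. by have [] := gr_subspace mu. Qed.

Lemma gr_lin mu x u v : gr mu u -> gr mu v -> gr mu (x *: u + v).
Proof. by have [_] := gr_subspace mu; apply. Qed.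

Lemma gcomp_hom mu a nu : gr mu a -> gcomp a nu = if nu == mu then a else 0.
Proof.
move=> ga; suff -> : gcomp a = (fun nu => if nu == mu then a else 0) by [].
apply: gcomp_unique => [xi||].
- by case: eqP => [->//|_]; exact: gr0.
- apply: (@sub_finite_set _ _ [set mu]) => // xi /=.
  by case: (xi =P mu) => // _; rewrite eqxx.
- rewrite (@fsum_supp _ [fset mu]%fset); first by rewrite big_seq_fset1 eqxx.
  by move=> xi; rewrite inE => /negPf ->.
Qed.

Definition gproj mu v : V := gcomp v mu.

Lemma gproj_linear mu : linear (gproj mu).
Proof.
move=> x u v; rewrite /gproj.
suff -> : gcomp (x *: u + v) = (fun nu => x *: gcomp u nu + gcomp v nu) by [].
have [gu _ eu] := gcompP u; have [gv _ ev] := gcompP v.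
have [A hA] := gcomp_supp u; have [B hB] := gcomp_supp v.
have hA' nu : nu \notin (A `|` B)%fset -> gcomp u nu = 0.
  by rewrite inE negb_or => /andP[/hA].
have hB' nu : nu \notin (A `|` B)%fset -> gcomp v nu = 0.
  by rewrite inE negb_or => /andP[_ /hB].
apply: gcomp_unique => [nu||]; first exact: gr_lin.
- apply: (@sub_finite_set _ _ [set` (A `|` B)%fset]) => // nu /=.
  by apply: contraNT => h; rewrite hA' // hB' // scaler0 addr0.
- rewrite {1}eu {1}ev (fsum_supp hA') (fsum_supp hB').
  rewrite (@fsum_supp _ (A `|` B)%fset); last first.
    by move=> nu h; rewrite hA' // hB' // scaler0 addr0.
  by rewrite scaler_sumr -big_split.
Qed.

HB.instance Definition _ mu :=
  GRing.isLinear.Build C V V *:%R (gproj mu) (gproj_linear mu).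

Lemma gr_ind (P : V -> Prop) : P 0 ->
  (forall x u v, P u -> P v -> P (x *: u + v)) ->
  (forall mu a, gr mu a -> P a) -> forall v, P v.
Proof.
move=> P0 PD Ph v; have [gv _ ->] := gcompP v; have [A hA] := gcomp_supp v.
rewrite (fsum_supp hA); elim/big_rec: _ => // mu u _ Pu.
by rewrite -[gcomp v mu]scale1r; apply: PD => //; exact: Ph.
Qed.

(** Later congruences modulo [O(V)] are phrased as equalities of linear maps into the quotient, so
    that this lemma reduces them to homogeneous vectors. *)
Lemma gr_ext (W : lmodType C) (f g : {linear V -> W}) :
  (forall mu a, gr mu a -> f a = g a) -> f =1 g.
Proof.
move=> fg; apply: gr_ind => //; first by rewrite !raddf0.
by move=> x u v eu ev; rewrite !linearP eu ev.
Qed.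

(** The common shape of [circ] and [star] as functions of their left factor. *)
Definition componentwise (F : C -> V -> V) v : V :=
  \sum_(mu \in [set: C]) F mu (gcomp v mu).

Lemma componentwise_hom (F : C -> {linear V -> V}) mu a :
  gr mu a -> componentwise F a = F mu a.
Proof.
move=> ga; rewrite /componentwise (@fsum_supp _ [fset mu]%fset).
  by rewrite big_seq_fset1 (gcomp_hom _ ga) eqxx.
by move=> nu; rewrite inE (gcomp_hom _ ga) => /negPf ->; rewrite raddf0.
Qed.

Lemma componentwise_linear (F : C -> {linear V -> V}) :
  linear (componentwise F).
Proof.
move=> x u v; rewrite /componentwise.
have [A hA] := gcomp_supp u; have [B hB] := gcomp_supp v.
have hA' nu : nu \notin (A `|` B)%fset -> gcomp u nu = 0.
  by rewrite inE negb_or => /andP[/hA].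
have hB' nu : nu \notin (A `|` B)%fset -> gcomp v nu = 0.
  by rewrite inE negb_or => /andP[_ /hB].
have e nu : gcomp (x *: u + v) nu = x *: gcomp u nu + gcomp v nu.
  exact: (linearP (gproj nu)).
rewrite !(@fsum_supp _ (A `|` B)%fset).
- by rewrite scaler_sumr -big_split; apply: eq_bigr => nu _; rewrite e linearP.
- by move=> nu h; rewrite hB' // raddf0.
- by move=> nu h; rewrite hA' // raddf0.
- by move=> nu h; rewrite e hB' // hA' // scaler0 addr0 raddf0.
Qed.

(** Let [1_mu] be the components of the vacuum. For [b] of weight [la], the component of weight
    [la + mu] of [b = 1(-1)b] is [1_mu(-1)b], which is therefore zero when [mu] is nonzero. Hence
    [1_mu(-1)] vanishes on [V], and applying it to the vacuum gives [1_mu = 0]. *)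
Lemma vacuum_gr : gr 0 (vacuum V).
Proof.
have [gv _ ev] := gcompP (vacuum V); have [A hA] := gcomp_supp (vacuum V).
suff h mu : mu != 0 -> gcomp (vacuum V) mu = 0.
  rewrite ev (@fsum_supp _ [fset 0]%fset); first by rewrite big_seq_fset1.
  by move=> mu; rewrite inE; exact: h.
move=> mu0; rewrite -[LHS](va_creativity _).1.
suff z : nprod (gcomp (vacuum V) mu) (-1) =1 \0 by rewrite z.
apply: (@gr_ext V (nprod (gcomp (vacuum V) mu) (-1)) \0) => la b gb.
have gn nu : gr (la + nu) (nprod (gcomp (vacuum V) nu) (-1) b).
  by have := gr_nprod (-1) (gv nu) gb; rewrite mulrN1z opprK addrK.
have eb : b = \sum_(nu <- A) nprod (gcomp (vacuum V) nu) (-1) b.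
  have := va_vacuum (-1) b; rewrite eqxx {1}ev (fsum_supp hA) => {1}<-.
  exact: (raddf_sum (nprodl (-1) b)).
have : gproj (la + mu) b = 0.
  by rewrite /gproj (gcomp_hom _ gb) -subr_eq0 addrAC subrr add0r (negPf mu0).
rewrite {1}eb raddf_sum /= => sum0.
case: (boolP (mu \in A)) => [muA|/hA->]; last by rewrite nprod0l.
rewrite -{}sum0 (big_fsetD1 mu) //= /gproj (gcomp_hom _ (gn mu)) eqxx.
rewrite big1_fset ?addr0 // => nu; rewrite !inE => /andP[nm _] _.
by rewrite (gcomp_hom _ (gn nu)) (inj_eq (addrI _)) eq_sym (negPf nm).
Qed.

End Grading.

(** * Circle and star products of homogeneous vectors *)

Section Products.
Variables (R : realType) (V : cgradedVertexAlgebra R).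
Local Notation C := (R[i]).
Implicit Types (a b c u v : V) (mu nu : C) (m n l : int).
Local Notation one := (vacuum V).
Local Notation pi := (zhu_proj V).

Lemma circ_hom mu a b :
  gr mu a -> circ a b = resY (circ_exp mu) (circ_pole mu) a b.
Proof.
exact: (componentwise_hom (fun mu => resYl (circ_exp mu) (circ_pole mu) b)).
Qed.

Lemma star_hom mu a b :
  gr mu a -> star a b = (wshift mu == 0)%:R *: resY mu 1 a b.
Proof.
exact: (componentwise_hom (fun mu => ((wshift mu == 0)%:R : C) \*: resYl mu 1 b)).
Qed.

Lemma circ_linearl b : linear (fun a => circ a b).
Proof.
exact: (componentwise_linear (fun mu => resYl (circ_exp mu) (circ_pole mu) b)).
Qed.

Lemma star_linearl b : linear (fun a => star a b).
Proof.
exact: (componentwise_linear (fun mu => ((wshift mu == 0)%:R : C) \*: resYl mu 1 b)).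
Qed.

Lemma star_linear a : linear (star a).
Proof.
move=> x u v; have [A hA] := gcomp_supp a.
have hA' w mu : mu \notin A -> hstar mu (gcomp a mu) w = 0.
  by move=> /hA ->; rewrite /hstar [resY _ _ _ _](raddf0 (resYl _ _ _)) scaler0.
rewrite /star !(fsum_supp (hA' _)) scaler_sumr -big_split.
apply: eq_bigr => mu _ /=.
by rewrite /hstar linearP scalerDr !scalerA mulrC.
Qed.

HB.instance Definition _ a :=
  GRing.isLinear.Build C V V *:%R (star a) (star_linear a).

Definition starl b a : V := star a b.

HB.instance Definition _ b :=
  GRing.isLinear.Build C V V *:%R (starl b) (star_linearl b).

Lemma star_int n a b : gr n%:~R a -> star a b = resY n%:~R 1 a b.
Proof. by move=> ga; rewrite (star_hom _ ga) wshift_int eqxx scale1r. Qed.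

Lemma star_nonint mu a b : wshift mu != 0 -> gr mu a -> star a b = 0.
Proof. by move=> /negPf hmu ga; rewrite (star_hom _ ga) hmu scale0r. Qed.

Lemma zhu_proj_circ mu a b : gr mu a ->
  pi (resY (circ_exp mu) (circ_pole mu) a b) = 0.
Proof.
move=> ga; apply/zhu_proj_eq0; rewrite -(circ_hom _ ga).
exists [:: (1, circ a b)]; last by rewrite big_seq1 scale1r.
by move=> p; rewrite inE => /eqP -> /=; exists (a, b).
Qed.

(** Homogeneous left factors suffice because [f] and the circle product are linear in that
    factor. *)
Lemma Oset_ind (W : lmodType C) (f : {linear V -> W}) :
  (forall mu a b, gr mu a ->
     f (resY (circ_exp mu) (circ_pole mu) a b) = 0) ->
  forall v, pi v = 0 -> f v = 0.
Proof.
move=> f0 v /zhu_proj_eq0 [s hs ->]; rewrite linear_sum big1_seq // => p /= ps.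
have [[a b] _ <-] := hs _ ps; rewrite linearZ /=.
suff -> : f (circ a b) = 0 by rewrite scaler0.
pose circl a := circ a b.
pose circb : {linear V -> V} :=
  HB.pack circl (GRing.isLinear.Build C V V *:%R circl (circ_linearl b)).
rewrite -[f _]/((f \o circb) a) (@gr_ext _ _ _ (f \o circb) \0) // => mu x gx.
by rewrite /= /circl (circ_hom _ gx) f0.
Qed.

Lemma nprod_gr mu nu a b n : gr mu a -> gr nu b ->
  gr (mu + nu + (- n - 1)%:~R) (nprod a n b).
Proof.
move=> ga gb; have := gr_nprod n ga gb.
by rewrite [nu + mu]addrC -addrA rmorphB rmorphN rmorph1.
Qed.

Lemma translationE a : translation a = nprod a (- 2) one.
Proof.
rewrite -[LHS](va_creativity _).1 va_translation_deriv.
by rewrite mulrN1z opprK -opprD.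
Qed.

Lemma translation_gr mu a : gr mu a -> gr (mu + 1) (translation a).
Proof.
move=> ga; rewrite translationE.
by have := nprod_gr (- 2) ga (vacuum_gr V); rewrite addr0.
Qed.

(* Integration by parts: passing from [a] to [translation a] raises both the
   exponent and the order of the pole by one. *)
Lemma zhu_proj_resY (s t : nat) mu a b : gr mu a -> (s <= t)%N ->
  pi (resY (circ_exp mu + s%:R) (circ_pole mu + t%:Z) a b) = 0.
Proof.
elim: t s mu a => [|t IHt] s mu a ga.
  by rewrite leqn0 => /eqP ->; rewrite !addr0 zhu_proj_circ.
(* The diagonal case [s = t + 1]: apply the induction hypothesis to [translation a], of weight
   [mu + 1]. The coefficient [circ_pole mu + t] to be cancelled is positive. *)
have top : pi (resY (circ_exp mu + t.+1%:R) (circ_pole mu + t.+1%:Z) a b) = 0.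
  have gTa := translation_gr ga.
  have := IHt t _ _ gTa (leqnn t).
  rewrite (circ_expD mu 1) (circ_poleD mu 1) addrAC resY_translation linearB.
  rewrite !(linearZ_LR pi) (IHt _ _ _ ga (leqnn t)) scaler0 subr0.
  have -> : circ_exp mu + t%:R + 1 = circ_exp mu + t.+1%:R by rewrite -addrA natr1.
  have -> : circ_pole mu + t%:Z + 1 = circ_pole mu + t.+1%:Z by lia.
  move/eqP; rewrite scaler_eq0 => /orP[|/eqP//].
  rewrite intr_eq0 => /eqP h; exfalso; move: h.
  by rewrite /circ_pole; case: (wshift mu == 0) => /=; lia.
(* Descend from the diagonal by [resY_pascal]: lowering the exponent by one costs a term with the
   smaller pole, already known to vanish. *)
move=> les; have -> : s = (t.+1 - (t.+1 - s))%N by rewrite subKn.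
move: (t.+1 - s)%N => d {s les}; elim: d => [|d IHd]; first by rewrite subn0.
(* Once [d] reaches [t + 1], the truncated difference stays at zero and the claim repeats [IHd]. *)
have [ltd|led] := ltnP d t.+1; last first.
  by move: IHd; have := led; rewrite -subn_eq0 subnS => /eqP ->.
have := resY_pascal (circ_exp mu + (t.+1 - d.+1)%:R) (circ_pole mu + t%:Z) a b.
move/(congr1 pi); rewrite linearD (IHt _ _ _ ga) ?addr0; last first.
  by rewrite subSS leq_subr.
have -> : circ_pole mu + t%:Z + 1 = circ_pole mu + t.+1%:Z by lia.
have -> : circ_exp mu + (t.+1 - d.+1)%:R + 1 = circ_exp mu + (t.+1 - d)%:R.
  by rewrite -addrA natr1 -subSn.
by rewrite IHd => <-.
Qed.

Lemma zhu_proj_resY_int (s t : nat) n a b : gr n%:~R a -> (s <= t)%N ->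
  pi (resY (n%:~R + s%:R) (2 + t%:Z) a b) = 0.
Proof.
by move=> ga st; have := zhu_proj_resY b ga st; rewrite circ_exp_int circ_pole_int.
Qed.

Lemma zhu_proj_nonint mu a : wshift mu != 0 -> gr mu a -> pi a = 0.
Proof.
move=> /negPf hmu ga; have := zhu_proj_circ one ga.
(* The pole is simple, so by creativity only the mode [a(-1)] contributes. *)
rewrite /circ_pole hmu (@resYE _ _ 1); last first.
  move=> i i1; apply: (va_creativity a).2; lia.
by rewrite big_ord1 gbinom0 scale1r sub0r addr0 (va_creativity a).1.
Qed.

End Products.

(** * Skew symmetry, the ideal property and associativity modulo [O(V)] *)

Section ZhuProduct.
Variables (R : realType) (V : cgradedVertexAlgebra R).
Local Notation C := (R[i]).
Implicit Types (a b c u v : V) (mu nu : C) (m n l : int).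
Local Notation one := (vacuum V).
Local Notation pi := (zhu_proj V).

(** The Jacobi identity applied to the vacuum with [m = -1], [n = 0]: on the right, creativity
    leaves only [b(l)a(-1)1]. As [x(-1-i)1] is [T^i x / i!], the sum encodes the exponential of
    [-T]. *)
Lemma skew_symmetry a b l :
  nprod b l a = - ((-1) ^ l : C) *:
    \sum_(i \in [set: nat])
       ((-1) ^+ i : C) *: nprod (nprod a (l + i%:Z) b) (- 1 - i%:Z) one.
Proof.
have := va_jacobi a b one l (- 1) 0.
have l0 (n : int) v : 0 <= n -> nprod v n one = 0 by exact: (va_creativity v).2.
rewrite [RHS](@fsum_natE _ _ 1); last first.
  move=> i i1; rewrite (l0 (0 + i%:Z)) // (l0 (- 1 + i%:Z)); last by lia.
  by rewrite !(raddf0, subrr).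
rewrite big_ord1 expr0 mul1r gbinom0 scale1r l0 // raddf0 sub0r !addr0 add0r ?subr0.
rewrite (va_creativity a).1.
have -> : \sum_(i \in [set: nat]) gbinom (- 1)%:~R i *:
    nprod (nprod a (l + i%:Z) b) (- 1 + 0 - i%:Z) one
  = \sum_(i \in [set: nat])
       ((-1) ^+ i : C) *: nprod (nprod a (l + i%:Z) b) (- 1 - i%:Z) one.
  by apply: eq_fsbigr => i _; rewrite rmorphN1 gbinomN1 addr0.
move=> ->; rewrite scalerN scaleNr opprK scalerA.
by rewrite -expfzMl mulrNN mulr1 exp1rz scale1r.
Qed.

(** The vector is [T^i a / i!]. Each [T] raises the weight by one and acts modulo [O(V)] as minus
    the weight, so the scalars [-m], [-m-1], ... multiply to the binomial coefficient. *)
Lemma zhu_proj_descendant m a (i : nat) : gr m%:~R a ->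
  pi (nprod a (- 1 - i%:Z) one) = gbinom (- m%:~R : C) i *: pi a.
Proof.
elim: i m a => [|i IHi] m a ga.
  by rewrite subr0 (va_creativity a).1 gbinom0 scale1r.
(* The circle product of [a] with the vacuum is [a(-2)1 + m a(-1)1], that is [Ta + m a]. *)
have Tm : pi (translation a) = - m%:~R *: pi a.
  have := zhu_proj_resY_int one ga (leqnn 0); rewrite !addr0 (@resYE _ _ 2).
    rewrite big_ord_recr big_ord1 /= gbinom0 scale1r sub0r.
    rewrite -translationE (va_creativity a).1 gbinomSE gbinom0 subr0 divr1 mulr1.
    by rewrite linearD (linearZ_LR pi) scaleNr => /eqP; rewrite addr_eq0 => /eqP.
  by move=> j j2; apply: (va_creativity a).2; lia.
have nz : i.+1%:R != 0 :> C by rewrite pnatr_eq0.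
have gT : gr (m + 1)%:~R (translation a).
  by rewrite rmorphD /=; exact: translation_gr.
have := IHi _ _ gT; rewrite va_translation_deriv Tm scalerA.
have -> : - (nprod a (- 1 - i%:Z - 1) one *~ (- 1 - i%:Z))
   = (i.+1%:R : C) *: nprod a (- 1 - i.+1%:Z) one.
  rewrite -scaler_int -scaleNr; congr (_ *: nprod _ _ _); last by lia.
  by rewrite -rmorphN -[RHS]/(i.+1%:~R); congr (_%:~R); lia.
rewrite (linearZ_LR pi) => h; apply: (scalerI nz); rewrite h scalerA.
congr (_ *: _); rewrite rmorphD /=.
rewrite -[X in gbinom X i.+1](subrK 1) gbinom_absorb subrK mulrC.
by congr (_ * gbinom _ _); ring.
Qed.

(** Coefficient form of the substitution of [-z/(1+z)] for [z]. Skew symmetry and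
    [zhu_proj_descendant] give a double sum; on the antidiagonal [j + i = s], Vandermonde yields
    [gbinom (s - n) s], and upper negation turns it into [gbinom (n - 1) s], the two signs [(-1)^s]
    cancelling. *)
Lemma zhu_proj_skew m n a b : gr m%:~R a -> gr n%:~R b ->
  pi (resY m%:~R 1 a b) = pi (resY (n%:~R - 1) 1 b a).
Proof.
move=> ga gb; have [N1 h1] := resY_trunc a b 1; have [N2 h2] := resY_trunc b a 1.
pose N := (N1 + N2)%N.
have h1' (i : nat) : (N <= i)%N -> nprod a (i%:Z - 1) b = 0.
  by move=> ?; apply: h1; lia.
have h2' (i : nat) : (N <= i)%N -> nprod b (i%:Z - 1) a = 0.
  by move=> ?; apply: h2; lia.
rewrite (resYE _ h1') (resYE _ h2') !linear_sum.
pose F (j i : nat) := (gbinom (m%:~R : C) j * ((-1) ^+ (j + i)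
   * gbinom ((j + i)%:R - n%:~R - m%:~R : C) i)) *: pi (nprod b ((j + i)%N%:Z - 1) a).
transitivity (\sum_(j < N) \sum_(i < N) F j i).
  apply: eq_bigr => j _; rewrite (linearZ_LR pi) [nprod a _ b]skew_symmetry.
  rewrite (@fsum_natE _ _ N); last first.
    move=> i Ni; have -> : j%:Z - 1 + i%:Z = (j + i)%N%:Z - 1 by lia.
    by rewrite h2' ?(leq_trans Ni) ?leq_addl // nprod0l scaler0.
  rewrite (linearZ_LR pi) linear_sum !scaler_sumr; apply: eq_bigr => i _.
  have -> : j%:Z - 1 + i%:Z = (j + i)%N%:Z - 1 by lia.
  have gba : gr (n + m - (j + i)%N%:Z)%:~R (nprod b ((j + i)%N%:Z - 1) a).
    have := nprod_gr ((j + i)%N%:Z - 1) gb ga; rewrite -!rmorphD.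
    by congr (gr (_%:~R) _); lia.
  rewrite (linearZ_LR pi) (zhu_proj_descendant _ gba) /F !scalerA.
  congr (_ *: _).
  have -> : - (n + m - (j + i)%N%:Z)%:~R = (j + i)%:R - n%:~R - m%:~R :> C.
    by rewrite rmorphB rmorphD /=; ring.
  have -> : - (-1) ^ (j%:Z - 1) = (-1) ^+ j :> C.
    by rewrite exprzDr ?unitrN1 // -exprnP exprN1 invrN1 mulrN1 opprK.
  by rewrite exprD; ring.
rewrite triangular_sum; last first.
  by move=> i j Nij; rewrite /F h2' // raddf0 scaler0.
apply: eq_bigr => s _; rewrite (linearZ_LR pi).
transitivity (\sum_(j < s.+1) ((-1) ^+ s *
    (gbinom (m%:~R : C) j * gbinom (s%:R - n%:~R - m%:~R : C) (s - j)))
    *: pi (nprod b (s%:Z - 1) a)).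
  apply: eq_bigr => j _; rewrite /F subnKC; last by rewrite -ltnS.
  by congr (_ *: _); ring.
rewrite -scaler_suml -mulr_sumr gbinom_vandermonde; congr (_ *: _).
have -> : m%:~R + (s%:R - n%:~R - m%:~R) = s%:R - n%:~R :> C by ring.
by rewrite gbinom_negate mulrA -exprD addnn -mul2n exprM sqrrN expr1n expr1n mul1r.
Qed.

(** With [l = -1] every coefficient on the right is one. The terms with [a] outside have pole
    [i + 1], so those with [i > 0] lie in [O(V)]; the hypothesis kills those with [b] outside. It
    holds both for the circle exponents (ideal property) and for the star exponents
    (associativity). *)
Lemma zhu_proj_assoc n p k a b c : gr n%:~R a ->
  (forall (i : nat) v, pi (resY p (k + i.+1%:Z) b v) = 0) ->
  pi (\sum_(i \in [set: nat]) gbinom n%:~R i *: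
        resY (p + n%:~R - i%:R) k (nprod a (- 1 + i%:Z) b) c)
  = pi (resY n%:~R 1 a (resY p k b c)).
Proof.
move=> ga pb; have [N ->] := weighted_jacobi p n%:~R k (- 1) a b c.
have e (i : nat) : (-1) ^+ i * gbinom (- 1)%:~R i = 1 :> C.
  by rewrite rmorphN1 gbinomN1 -exprD addnn -mul2n exprM sqrrN expr1n expr1n.
have z (i : nat) v : pi (resY p (k + i%:Z - - 1) b v) = 0.
  by rewrite (_ : k + i%:Z - - 1 = k + i.+1%:Z) //; lia.
rewrite big_ord_recl linearD (linear_sum pi) big1 ?addr0; last first.
  move=> i _; rewrite lift0 e scale1r (linearB pi) (linearZ_LR pi).
  rewrite [X in _ *: X]z scaler0 subr0.
  have -> : i.+1%:Z - - 1 = 2 + i%:Z by lia.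
  by have := zhu_proj_resY_int (resY p (k - i.+1%:Z) b c) ga (leq0n i); rewrite addr0.
rewrite [nat_of_ord ord0](_ : _ = 0%N) //.
rewrite e scale1r (linearB pi) (linearZ_LR pi).
have z0 v : pi (resY p (k - - 1) b v) = 0 by have := z 0%N v; rewrite addr0.
by rewrite [X in _ *: X]z0 scaler0 subr0.
Qed.

(** With [l = 0] only [i = 0] survives on the right, leaving a commutator formula. *)
Lemma zhu_proj_comm n p k a b c :
  (forall (i : nat), pi (resY (p + n%:~R - i%:R) k (nprod a i%:Z b) c) = 0) ->
  (forall v, pi (resY p k b v) = 0) ->
  pi (resY n%:~R 0 a (resY p k b c)) = 0.
Proof.
move=> pab pb; have [N] := weighted_jacobi p n%:~R k 0 a b c.
rewrite big_ord_recl [X in _ = _ + X]big1 ?addr0; last first.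
  by move=> i _; rewrite lift0 gbinom0n mulr0 scale0r.
rewrite [nat_of_ord ord0](_ : _ = 0%N) // gbinom0 mulr1 expr0z !scale1r.
move=> /(congr1 pi); rewrite (linearB pi) [X in _ - X]pb subr0 => <-.
rewrite (linear_sum pi) big1 // => i _.
by rewrite (linearZ_LR pi) add0r pab scaler0.
Qed.

Lemma zhu_proj_ideal n c v : gr n%:~R c -> pi v = 0 ->
  pi (resY n%:~R 1 c v) = 0 /\ pi (resY (n%:~R - 1) 1 c v) = 0.
Proof.
move=> gc v0; have h1 : pi (resY n%:~R 1 c v) = 0.
  apply: (@Oset_ind _ _ _ (pi \o resY n%:~R 1 c) _ _ v0) => mu a b ga /=.
  rewrite -zhu_proj_assoc //; last first.
    by move=> i w; have := zhu_proj_resY w ga (leq0n i.+1); rewrite addr0.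
  rewrite linear_sum big1 // => i _; rewrite (linearZ_LR pi).
  (* The vector [c(i-1)a] has weight [mu + n - i], so the [i]-th term is a multiple of its circle
     product with [b]. *)
  have g := nprod_gr (- 1 + i%:Z) gc ga.
  rewrite [n%:~R + mu]addrC -addrA -rmorphD in g.
  have := zhu_proj_circ b g; rewrite circ_expD circ_poleD.
  have -> : n + (- (- 1 + i%:Z) - 1) = n - i%:Z by lia.
  by rewrite rmorphB /= addrA => ->; rewrite scaler0.
split=> //; have h0 : pi (resY (n - 1)%:~R 0 c v) = 0.
  apply: (@Oset_ind _ _ _ (pi \o resY (n - 1)%:~R 0 c) _ _ v0) => mu a b ga /=.
  apply: zhu_proj_comm => [i|w]; last exact: zhu_proj_circ.
  (* Here [c(i)a] has weight [mu + n - 1 - i], matching the exponent [n - 1]. *)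
  have g := nprod_gr i gc ga.
  rewrite [n%:~R + mu]addrC -addrA -rmorphD in g.
  have := zhu_proj_circ b g; rewrite circ_expD circ_poleD.
  have -> : n + (- i%:Z - 1) = n - 1 - i%:Z by lia.
  by rewrite [X in _ + X]rmorphB /= addrA.
have := resY_pascal (n%:~R - 1) 0 c v; rewrite subrK add0r => /(congr1 pi).
rewrite rmorphB rmorph1 in h0.
by rewrite h1 (linearD pi) h0 addr0 => <-.
Qed.

(** Every mode [a(i-k)b] has weight in [mu + nu] plus an integer, hence nonintegral weight, and
    vanishes in the quotient. *)
Lemma zhu_proj_resY_nonint p k mu nu a b : gr mu a -> gr nu b ->
  wshift (mu + nu) != 0 -> pi (resY p k a b) = 0.
Proof.
move=> ga gb hmu; rewrite linear_sum big1 // => i _; rewrite (linearZ_LR pi).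
rewrite (zhu_proj_nonint _ (nprod_gr (i%:Z - k) ga gb)) ?scaler0 //.
by rewrite wshiftD.
Qed.

Lemma wshift_intD n mu : wshift (n%:~R + mu) = wshift mu.
Proof. by rewrite addrC wshiftD. Qed.

Lemma gr_int mu a : wshift mu = 0 -> gr mu a -> exists n, gr n%:~R a.
Proof. by move=> /wshift_eq0 e ga; exists (ceil_weight mu); rewrite -e. Qed.

(** Turns right multiplication by [c] into an operator applied to [u], to which [zhu_proj_ideal]
    applies. For [u] of nonintegral weight both sides vanish. *)
Lemma zhu_proj_star_skew n u c : gr n%:~R c ->
  pi (star u c) = pi (resY (n%:~R - 1) 1 c u).
Proof.
move=> gc; apply: (@gr_ext _ _ _ (pi \o starl c) (pi \o resY (n%:~R - 1) 1 c)).
move=> mu a ga /=; rewrite /starl.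
have [mu0|mu0] := eqVneq (wshift mu) 0.
  by have [m gm] := gr_int mu0 ga; rewrite (star_int _ gm) (zhu_proj_skew gm gc).
by rewrite (star_nonint _ mu0 ga) raddf0 (zhu_proj_resY_nonint _ _ gc ga) ?wshift_intD.
Qed.

Lemma zhu_proj_star0r a v : pi v = 0 -> pi (star a v) = 0.
Proof.
move=> v0; apply: (@gr_ext _ _ _ (pi \o starl v) \0) a => mu a ga /=; rewrite /starl.
have [mu0|mu0] := eqVneq (wshift mu) 0; last first.
  by rewrite (star_nonint _ mu0 ga) raddf0.
have [m gm] := gr_int mu0 ga; rewrite (star_int _ gm).
exact: (zhu_proj_ideal gm v0).1.
Qed.

Lemma zhu_proj_star0l v c : pi v = 0 -> pi (star v c) = 0.
Proof.
move=> v0; apply: (@gr_ext _ _ _ (pi \o star v) \0) c => nu c gc /=.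
have [nu0|nu0] := eqVneq (wshift nu) 0.
  have [n gn] := gr_int nu0 gc; rewrite (zhu_proj_star_skew _ gn).
  exact: (zhu_proj_ideal gn v0).2.
(* For [c] of nonintegral weight the product vanishes in the quotient for every left factor, so [v]
   is generalized. *)
move: v {v0}; apply: (@gr_ext _ _ _ (pi \o starl c) \0) => mu a ga /=.
rewrite /starl.
have [mu0|mu0] := eqVneq (wshift mu) 0; last first.
  by rewrite (star_nonint _ mu0 ga) raddf0.
have [m gm] := gr_int mu0 ga; rewrite (star_int _ gm).
by rewrite (zhu_proj_resY_nonint _ _ gm gc) ?wshift_intD.
Qed.

Lemma star_nonint_l mu nu a b c : gr mu a -> gr nu b -> wshift (mu + nu) != 0 ->
  star (star a b) c = 0.
Proof.
move=> ga gb hmu; rewrite (star_hom _ ga).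
suff z : starl c (resY mu 1 a b) = 0.
  by rewrite -[LHS]/(starl c _) (linearZ_LR (starl c)) /= z scaler0.
rewrite linear_sum big1 // => i _; rewrite (linearZ_LR (starl c)) /= /starl.
by rewrite (star_nonint _ _ (nprod_gr _ ga gb)) ?scaler0 // wshiftD.
Qed.

Lemma zhu_proj_starA a b c : pi (star (star a b) c) = pi (star a (star b c)).
Proof.
apply: (@gr_ext _ _ _ (pi \o starl c \o starl b) (pi \o starl (star b c)))
  a => mu a ga /=.
rewrite /starl; have [mu0|mu0] := eqVneq (wshift mu) 0; last first.
  by rewrite !(star_nonint _ mu0 ga) [star 0 c](raddf0 (starl c)).
have {mu0}[m gm] := gr_int mu0 ga.
apply: (@gr_ext _ _ _ (pi \o starl c \o star a) (pi \o star a \o starl c))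
  b => nu b gb /=.
rewrite /starl; have [nu0|nu0] := eqVneq (wshift nu) 0; last first.
  by rewrite (star_nonint_l _ gm gb) ?wshift_intD // (star_nonint _ nu0 gb) (raddf0 (star a)).
have {nu0}[n gn] := gr_int nu0 gb.
rewrite (star_int _ gn) !(star_int _ gm) -zhu_proj_assoc //; last first.
  move=> i v; have := zhu_proj_resY_int v gn (leq0n i); rewrite addr0.
  by rewrite (_ : 2 + i%:Z = 1 + i.+1%:Z) //; lia.
congr (pi _); have [N hN] := resY_trunc a b 1.
rewrite (resYE _ hN) (@fsum_natE _ _ N); last first.
  move=> i Ni; rewrite addrC hN //.
  by rewrite [resY _ _ _ _](raddf0 (resYl _ _ _)) scaler0.
rewrite -[LHS]/(starl c _) linear_sum; apply: eq_bigr => i _; rewrite linearZ /=.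
rewrite /starl; congr (_ *: _).
(* The weight [m + n - i] of [a(i-1)b] is the exponent of its star product with [c], so the two sums
   agree term by term. *)
have g := nprod_gr (i%:Z - 1) gm gn; rewrite -!rmorphD in g.
have e : m + n + (- (i%:Z - 1) - 1) = n + m - i%:Z by lia.
rewrite e in g; rewrite (star_int _ g) [- 1 + i%:Z]addrC.
by rewrite rmorphB rmorphD.
Qed.

Lemma star1l b : star one b = b.
Proof.
rewrite (star_int (n := 0) _ (vacuum_gr V)) (@resYE _ _ 1); last first.
  by move=> i i1; rewrite va_vacuum; case: eqP => //; lia.
by rewrite big_ord1 gbinom0 scale1r va_vacuum.
Qed.

(** Integral components are reproduced by creativity; nonintegral ones are killed by [star] and are
    zero in the quotient. *)
Lemma zhu_proj_star1r a : pi (star a one) = pi a.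
Proof.
apply: (@gr_ext _ _ _ (pi \o starl one) pi) a => mu a ga /=; rewrite /starl.
have [mu0|mu0] := eqVneq (wshift mu) 0; last first.
  by rewrite (star_nonint _ mu0 ga) raddf0 (zhu_proj_nonint mu0 ga).
have [m gm] := gr_int mu0 ga; rewrite (star_int _ gm) (@resYE _ _ 1).
  by rewrite big_ord1 gbinom0 scale1r (va_creativity a).1.
by move=> i i1; apply: (va_creativity a).2; lia.
Qed.

End ZhuProduct.

Theorem theorem3p8 (R : realType) (V : cgradedVertexAlgebra R) :
  exists mul : zhu V -> zhu V -> zhu V,
    (forall a b : V, mul (zhu_proj V a) (zhu_proj V b) = zhu_proj V (star a b))
    /\ is_assoc_algebra mul.
Proof.
pose lift (x : zhu V) : V := projT1 (cid (zhu_proj_surj x)).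
have liftK x : zhu_proj V (lift x) = x by rewrite /lift; case: cid.
pose mul x y := zhu_proj V (star (lift x) (lift y)).
have mulE a b : mul (zhu_proj V a) (zhu_proj V b) = zhu_proj V (star a b).
  have ker u : zhu_proj V (lift (zhu_proj V u) - u) = 0.
    by rewrite linearB liftK subrr.
  (* Independence of the chosen representatives: change one factor at a time and use the two halves
     of the ideal property. *)
  have bil u u' v v' : star u v - star u' v' = star (u - u') v + star u' (v - v').
    by rewrite linearB -[star (u - u') v]/(starl v _) linearB subrKA.
  apply/eqP; rewrite /mul -subr_eq0 -(linearB (zhu_proj V)) bil.
  by rewrite linearD zhu_proj_star0l // zhu_proj_star0r // addr0.
exists mul; split=> //; split.
- move=> x k y z; rewrite -(liftK x) -(liftK y) -(liftK z) -linearP !mulE.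
  by rewrite !linearP.
- move=> y k x z; rewrite -(liftK x) -(liftK y) -(liftK z) -linearP !mulE.
  by rewrite -linearP -(linearP (starl _)).
- move=> x y z; rewrite -(liftK x) -(liftK y) -(liftK z) !mulE.
  by rewrite zhu_proj_starA.
- exists (zhu_proj V (vacuum V)); split=> x; rewrite -(liftK x) mulE.
    by rewrite star1l.
  by rewrite zhu_proj_star1r.
Qed.
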